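(* Let $1\le k\le n$ be integers, let $\mathcal{J}\subset\binom{[n]}{k}$ be an arrangement of largest minors in $Gr^+(k,n)$, put $c=|\mathcal{J}|$, and let $W\in\binom{[n]}{k}$ with $W\notin\mathcal{J}$. If $W$ is a $(2,\mathcal{J})$-largest minor, then at least one of the following conditions (1), (2) holds; equivalently, at least one of the conditions (3), (4) holds (i.e. ''(1) or (2)'' is equivalent to ''(3) or (4)''). (1) The collection $\{W\}\cup\mathcal{J}$ is sorted. (2) There exists $J\in\mathcal{J}$ such that $W$ and $J$ are not sorted, and $(\mathcal{J}\setminus\{J\})\cup\{W\}$ is a sorted collection. (3) $\nabla_{\{W\}\cup\mathcal{J}}$ is a $c$-dimensional simplex in Sturmfels' triangulation of the hypersimplex $\Delta_{k,n}$. (4) There exists a $(c-1)$-dimensional simplex $\nabla_{\mathcal{Y}}$ in Sturmfels' triangulation of $\Delta_{k,n}$ such that $\epsilon_W$ is a vertex of $\nabla_{\mathcal{Y}}$ and the simplices $\nabla_{\mathcal{Y}}$ and $\nabla_{\mathcal{J}}$ share a common facet.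
   Context: Notation: $[n]=\{1,\dots,n\}$ and $\binom{[n]}{k}$ is the set of $k$-element subsets of $[n]$. For a real $k\times n$ matrix $A$ of rank $k$ and $I\in\binom{[n]}{k}$, $\Delta_I(A)$ is the determinant of the $k\times k$ submatrix with column set $I$ (in increasing order). The positive Grassmannian $Gr^+(k,n)$ is the set of points of the real Grassmannian $Gr(k,n)$ (matrices modulo row operations) represented by matrices $A$ with $\Delta_I(A)>0$ for all $I$; equalities and inequalities between the $\Delta_I$ are taken for such representatives (they are defined up to a common positive factor). Arrangements: An arrangement of minors with $\mathcal{U}_0=\emptyset$ is an ordered set partition $\mathcal{U}=(\mathcal{U}_0,\mathcal{U}_1,\dots,\mathcal{U}_l)$ of $\binom{[n]}{k}$ with $\mathcal{U}_0=\emptyset$ and $\mathcal{U}_1,\dots,\mathcal{U}_l$ nonempty, for which there is a point of $Gr^+(k,n)$ with $\Delta_I=\Delta_J$ whenever $I,J$ lie in the same $\mathcal{U}_i$, and $\Delta_I<\Delta_J$ whenever $I\in\mathcal{U}_i$, $J\in\mathcal{U}_j$ with $i<j$. A set $\mathcal{J}\subset\binom{[n]}{k}$ is an arrangement of largest minors if there is such an arrangement $\mathcal{U}$ with $\mathcal{U}_l=\mathcal{J}$. For $t\ge2$, $\mathcal{Y}$ is a $(t,\mathcal{J})$-largest arrangement if there is such a $\mathcal{U}$ with $\mathcal{U}_l=\mathcal{J}$ and $\mathcal{U}_{l-t+1}=\mathcal{Y}$ (with $l-t+1\ge1$); $W$ is a $(t,\mathcal{J})$-largest minor if $W$ belongs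 to some $(t,\mathcal{J})$-largest arrangement. Sortedness: For $I,J\in\binom{[n]}{k}$ let $a_1\le a_2\le\dots\le a_{2k}$ be the non-decreasing rearrangement of the multiset union of $I$ and $J$; put $Sort_1(I,J)=\{a_1,a_3,\dots,a_{2k-1}\}$ and $Sort_2(I,J)=\{a_2,a_4,\dots,a_{2k}\}$. The pair $I,J$ is sorted if $\{I,J\}=\{Sort_1(I,J),Sort_2(I,J)\}$. A collection of $k$-subsets is sorted if every two of its elements are sorted. Sturmfels' triangulation: For $I\in\binom{[n]}{k}$, $\epsilon_I\in\{0,1\}^n$ is the indicator vector of $I$. The hypersimplex is $\Delta_{k,n}=\{x\in[0,1]^n: x_1+\dots+x_n=k\}$. For a sorted collection $\mathcal{I}$ of size $r$, $\nabla_{\mathcal{I}}$ is the $(r-1)$-dimensional simplex with vertices $\epsilon_I$, $I\in\mathcal{I}$. The simplices $\nabla_{\mathcal{I}}$, over all sorted collections $\mathcal{I}$, form a triangulation of $\Delta_{k,n}$, called Sturmfels' triangulation. (It is known that arrangements of largest minors are exactly the nonempty sorted collections, so $\nabla_{\mathcal{J}}$ makes sense.) A facet of a $d$-dimensional simplex is a $(d-1)$-dimensional face, with the convention that the facet of a $0$-dimensional simplex is the empty face. *)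

(* Defs.v *)
From mathcomp Require Import classical_sets reals.
From mathcomp Require Import all_boot all_order all_algebra.

Set Implicit Arguments.
Unset Strict Implicit.
Unset Printing Implicit Defensive.

Import GRing.Theory Num.Theory.
Local Open Scope ring_scope.

(* The ground set [n] is 'I_n = {0, ..., n-1}. *)
Notation ksubset k n := {I : {set 'I_n} | #|I| == k}.

(* [enum_val] lists I in increasing order. *)
Definition minor (R : realType) (k n : nat) (A : 'M[R]_(k, n))
    (I : ksubset k n) : R :=
  \det (colsub
    (fun j : 'I_k => enum_val (cast_ord (esym (eqP (valP I))) j)) A).

(* A represents a point of Gr^+(k, n). *)
Definition positive_rep (R : realType) (k n : nat) (A : 'M[R]_(k, n)) : Prop :=
  row_free A /\ forall I : ksubset k n, 0 < minor A I.

(* U = (U_0, ..., U_l) is an arrangement of minors with U_0 empty. *)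
Definition arrangement (R : realType) (k n l : nat)
    (U : 'I_l.+1 -> {set ksubset k n}) : Prop :=
  [/\ forall i : 'I_l.+1, (U i == finset.set0) = (i == ord0),
      forall i j : 'I_l.+1, i != j -> [disjoint U i & U j],
      forall I : ksubset k n, exists i : 'I_l.+1, I \in U i
    & exists A : 'M[R]_(k, n),
        [/\ positive_rep A,
            forall (i : 'I_l.+1) (I J : ksubset k n),
              I \in U i -> J \in U i -> minor A I = minor A J
          & forall (i j : 'I_l.+1) (I J : ksubset k n),
              (i < j)%N -> I \in U i -> J \in U j -> minor A I < minor A J]].

Definition arrangement_of_largest (R : realType) (k n : nat)
    (J : {set ksubset k n}) : Prop :=
  exists (l : nat) (U : 'I_l.+1 -> {set ksubset k n}),
    arrangement R U /\ U ord_max = J.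

(* The index i is l - t + 1, required to be at least 1; meant for t >= 2. *)
Definition largest_arrangement (R : realType) (k n t : nat)
    (J Y : {set ksubset k n}) : Prop :=
  exists (l : nat) (U : 'I_l.+1 -> {set ksubset k n}) (i : 'I_l.+1),
    [/\ arrangement R U, U ord_max = J,
        (0 < i)%N, (i + t = l.+1)%N & U i = Y].

Definition largest_minor (R : realType) (k n t : nat)
    (J : {set ksubset k n}) (W : ksubset k n) : Prop :=
  exists2 Y : {set ksubset k n}, largest_arrangement R t J Y & W \in Y.

(* a_1 <= ... <= a_2k; the item a_(i+1) has position i in this sequence. *)
Definition sorted_union (k n : nat) (I J : ksubset k n) : seq 'I_n :=
  sort (fun x y : 'I_n => (x <= y)%N) (enum (val I) ++ enum (val J)).

Definition Sort1 (k n : nat) (I J : ksubset k n) : {set 'I_n} :=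
  [set x : 'I_n | [exists i : 'I_k, onth (sorted_union I J) i.*2 == Some x]].

Definition Sort2 (k n : nat) (I J : ksubset k n) : {set 'I_n} :=
  [set x : 'I_n | [exists i : 'I_k, onth (sorted_union I J) i.*2.+1 == Some x]].

Definition sorted_pair (k n : nat) (I J : ksubset k n) : bool :=
  [set val I; val J] == [set Sort1 I J; Sort2 I J].

Definition sorted_collection (k n : nat) (C : {set ksubset k n}) : Prop :=
  {in C &, forall I J : ksubset k n, sorted_pair I J}.

(* Convex hull of the points v t, t \in A; it is empty when A is. *)
Definition hull (R : realType) (n : nat) (T : finType) (v : T -> 'rV[R]_n)
    (A : {set T}) : set 'rV[R]_n :=
  fun x => exists c : T -> R,
    [/\ forall t, 0 <= c t, \sum_(t in A) c t = 1
      & x = \sum_(t in A) c t *: v t].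

Definition affinely_independent (R : realType) (n : nat) (T : finType)
    (v : T -> 'rV[R]_n) : Prop :=
  forall c : T -> R,
    \sum_t c t = 0 -> \sum_t c t *: v t = 0 -> forall t, c t = 0.

Definition simplex_on (R : realType) (n d : nat) (v : 'I_d.+1 -> 'rV[R]_n)
    (S : set 'rV[R]_n) : Prop :=
  affinely_independent v /\ S = hull v [set: 'I_d.+1].

Definition simplex (R : realType) (n d : nat) (S : set 'rV[R]_n) : Prop :=
  exists v : 'I_d.+1 -> 'rV[R]_n, simplex_on v S.

Definition vertex (R : realType) (n : nat) (x : 'rV[R]_n)
    (S : set 'rV[R]_n) : Prop :=
  exists (d : nat) (v : 'I_d.+1 -> 'rV[R]_n),
    simplex_on v S /\ exists i : 'I_d.+1, x = v i.

(* A facet is spanned by all vertices but one; for d = 0 it is empty. *)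
Definition facet (R : realType) (n : nat) (F S : set 'rV[R]_n) : Prop :=
  exists (d : nat) (v : 'I_d.+1 -> 'rV[R]_n),
    simplex_on v S /\ exists i : 'I_d.+1, F = hull v [set~ i].

Definition eps (R : realType) (k n : nat) (I : ksubset k n) : 'rV[R]_n :=
  \row_(j < n) (j \in val I)%:R.
Arguments eps R {k n} I.

Definition nabla (R : realType) (k n : nat) (C : {set ksubset k n}) :
    set 'rV[R]_n :=
  hull (@eps R k n) C.
Arguments nabla R {k n} C.

Definition sturmfels (R : realType) (k n : nat) : set (set 'rV[R]_n) :=
  fun S => exists2 C : {set ksubset k n}, sorted_collection C & S = nabla R C.
Arguments sturmfels : clear implicits.

(* Main.v *)
(* Write h_S(j) = |{x in S : x < j}|.  Then h_{Sort_1(I,J)} and h_{Sort_2(I,J)} are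
   the upper and lower halves of h_I + h_J, so I, J are sorted exactly when
   h_I - h_J takes values in {0, 1} or in {-1, 0}.

   If I, J are not sorted, some level l satisfies min < l < max for the closed path
   h_I - h_J.  Rotate [n] cyclically so that the path starts at level l (the
   three-term Pluecker inequalities are invariant under rotation), and exchange
   I and J on the part of the path above its base.  Each rise of an excursion
   above (below) the base is matched with a fall, and the inequalities
   D_ab D_cd, D_ad D_bc < D_ac D_bd (a < b < c < d) for one matched pair above and
   one below multiply up to D_I D_J < D_I' D_J', with eps_I + eps_J = eps_I' + eps_J'.

   Hence largest minors form a sorted collection, and if the second largest W is not
   sorted with K in J, both I' and J' lie in J: eps_W = eps_I' + eps_J' - eps_K is an
   affine combination of J.  A sorted collection is affinely independent, so K is
   determined by W. *)
Require Import Defs.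
From mathcomp Require Import classical_sets reals.
From mathcomp Require Import all_boot all_order all_algebra.
From mathcomp Require Import perm zify ring lra.

Set Implicit Arguments.
Unset Strict Implicit.
Unset Printing Implicit Defensive.

Import Order.TTheory GRing.Theory Num.Theory.

(** * Counting functions of subsets as lattice paths *)

(** The function h_S. As [n] is numbered from 0, the element x accounts for the step from x to x +
    1, and j runs from 0 to n. *)
Definition below (n : nat) (S : {set 'I_n}) (j : nat) : nat :=
  #|[set x in S | x < j]|.

Lemma below0 n (S : {set 'I_n}) : below S 0 = 0.
Proof. by apply/eqP; rewrite cards_eq0; apply/eqP/setP=> x; rewrite !inE andbF. Qed.

Lemma belowS n (S : {set 'I_n}) (x : 'I_n) : below S x.+1 = below S x + (x \in S).
Proof.
rewrite /below; case: (boolP (x \in S)) => xS; last first.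
  rewrite addn0; congr #|pred_of_set _|; apply/setP=> y; rewrite !inE ltnS.
  case: (boolP (y \in S)) => //= yS; rewrite leq_eqVlt.
  by case: eqP => // /val_inj eyx; rewrite -eyx yS in xS.
rewrite addn1 -(_ : #|x |: [set y in S | y < x]| = (#|[set y in S | y < x]|).+1).
  congr #|pred_of_set _|; apply/setP=> y; rewrite !inE ltnS leq_eqVlt -val_eqE /=.
  by case: eqP => //= /val_inj ->; rewrite xS.
by rewrite cardsU1 !inE ltnn andbF.
Qed.

Lemma below_full n (S : {set 'I_n}) : below S n = #|S|.
Proof. by congr #|pred_of_set _|; apply/setP=> x; rewrite !inE ltn_ord andbT. Qed.

Lemma below_mono n (S : {set 'I_n}) i j : i <= j -> below S i <= below S j.
Proof.
move=> ij; apply/subset_leq_card/subsetP=> x; rewrite !inE => /andP[-> /=].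
by move/leq_trans; apply.
Qed.

Lemma below_inj n (S T : {set 'I_n}) :
  (forall j, j <= n -> below S j = below T j) -> S = T.
Proof.
move=> h; apply/setP=> x; have := h x.+1 (ltn_ord x).
rewrite !belowS (h x (ltnW (ltn_ord x))) => /addnI.
by do 2!case: (_ \in _).
Qed.

Lemma below_count n (S : {set 'I_n}) j :
  below S j = count (fun i : nat => i < j) [seq val x | x <- enum S].
Proof.
rewrite count_map /below cardE -size_filter.
set T := [set x in S | _].
have: perm_eq (enum T) [seq x : 'I_n <- enum S | x < j].
  apply: uniq_perm => [||x]; [exact: enum_uniq | exact/filter_uniq/enum_uniq |].
  by rewrite [RHS]mem_filter !mem_enum inE andbC.
exact: perm_size.
Qed.

Lemma enum_set_sorted n (S : {set 'I_n}) : sorted ltn [seq val x | x <- enum S].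
Proof.
rewrite sorted_map /enum_mem; apply: sorted_filter; first exact: ltn_trans.
by have := iota_ltn_sorted 0 n; rewrite -val_enum_ord sorted_map enumT.
Qed.

Lemma below_nth n (S : {set 'I_n}) x0 i :
  i < #|S| -> below S (nth x0 (enum S) i) = i.
Proof.
rewrite cardE => iS; rewrite below_count -(nth_map _ (val x0) val) //.
by apply: (count_lt_nth (val x0) (enum_set_sorted S)); rewrite size_map.
Qed.

(** * Sorted pairs as interlaced paths *)

(** The copies of x in the sorted multiset union fill an interval of positions that starts right
    after all smaller items; multiplicities 0, 1 and 2 are covered at once. *)
Lemma onth_sorted_union k n (I J : ksubset k n) i (x : 'I_n) :
  (onth (sorted_union I J) i == Some x) =
  (below (val I) x + below (val J) x <= i < below (val I) x.+1 + below (val J) x.+1).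
Proof.
set s := sorted_union I J; pose sv := [seq val y | y <- s].
have sv_sorted : sorted leq sv.
  by rewrite sorted_map; apply: sort_sorted => y z; apply: leq_total.
have countE j : count (fun y => y < j) sv = below (val I) j + below (val J) j.
  rewrite !below_count -count_cat -map_cat; apply/seq.permP/perm_map.
  by rewrite perm_sort.
rewrite -!countE; apply/eqP/idP => [sx|/andP[lo hi]].
  have nx : nth 0 sv i = x by apply: onth_nth; rewrite onth_map sx.
  have isz : i < size sv by rewrite size_map -onthTE sx.
  apply/andP; split; rewrite leqNgt; apply/negP => h.
    by have := nth_count_lt 0 sv_sorted h; rewrite nx ltEnat /= ltnn.
  have := @nth_count_ge _ nat x.+1 0 _ i sv_sorted.
  rewrite isz andbT nx leEnat ltnn => hh.
  by have: false by apply: hh; rewrite -ltnS.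
have isz : i < size sv by apply: leq_trans hi (count_size _ _).
have := @nth_count_ge _ nat x 0 _ i sv_sorted; rewrite isz andbT => /(_ lo).
have := @nth_count_lt _ nat x.+1 0 _ i sv_sorted hi.
rewrite leEnat ltEnat /= ltnS => le1 le2.
have nx : nth 0 sv i = x by apply/eqP; rewrite eqn_leq le1 le2.
rewrite size_map -onthTE in isz.
case E: (onth s i) isz => [y|] // _; congr Some; apply: val_inj.
by rewrite /= -nx; apply/esym/onth_nth; rewrite onth_map E.
Qed.

Section SortBelow.
Variables (k n : nat) (I J : ksubset k n).
Let N j := below (val I) j + below (val J) j.

Let NS (x : 'I_n) : N x <= N x.+1 <= (N x).+2.
Proof. by rewrite /N !belowS; case: (_ \in _); case: (_ \in _) => /=; lia. Qed.

Let N_le j : j <= n -> N j <= k.*2.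
Proof.
move=> jn; rewrite /N -addnn leq_add //.
  by rewrite -[X in _ <= X](eqP (valP I)) -below_full below_mono.
by rewrite -[X in _ <= X](eqP (valP J)) -below_full below_mono.
Qed.

(** Positions count from 0, so a_1, a_3, ... sit at the even ones, and [uphalf N] of the first N
    positions are even. One more value of j adds at most two items, hence at most one at an even
    position. *)
Lemma below_Sort1 j : j <= n -> below (Sort1 I J) j =
  uphalf (below (val I) j + below (val J) j).
Proof.
rewrite -/(N j).
elim: j => [|j IHj] jn; first by rewrite /N !below0.
have := NS (Ordinal jn); have := N_le jn => /= h1 h2.
rewrite (belowS (Sort1 I J) (Ordinal jn)) [below _ _](IHj (ltnW jn)) inE.
case: existsP => [[i]|no]; first by  rewrite onth_sorted_union /= -/(N _) -/(N _); lia.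
suff : uphalf (N j) = uphalf (N j.+1) by lia.
apply/eqP/negPn/negP => ne; case: no.
(* The first even position from [N j] on is the double of [uphalf (N j)]. *)
have ik : uphalf (N j) < k by lia.
exists (Ordinal ik); rewrite onth_sorted_union /= -/(N _) -/(N _); lia.
Qed.

Lemma below_Sort2 j : j <= n -> below (Sort2 I J) j =
  (below (val I) j + below (val J) j)./2.
Proof.
rewrite -/(N j).
elim: j => [|j IHj] jn; first by rewrite /N !below0.
have := NS (Ordinal jn); have := N_le jn => /= h1 h2.
rewrite (belowS (Sort2 I J) (Ordinal jn)) [below _ _](IHj (ltnW jn)) inE.
case: existsP => [[i]|no]; first by rewrite onth_sorted_union /= -/(N _) -/(N _); lia.
suff : (N j)./2 = (N j.+1)./2 by lia.
apply/eqP/negPn/negP => ne; case: no.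
have ik : (N j)./2 < k by lia.
exists (Ordinal ik); rewrite onth_sorted_union /= -/(N _) -/(N _); lia.
Qed.

End SortBelow.

Definition interlaced n (S T : {set 'I_n}) : Prop :=
  forall j, j <= n -> below T j <= below S j <= (below T j).+1.

(** Two integers are the upper and lower halves of their sum exactly when the first minus the second
    is 0 or 1; this is applied at every j. *)
Lemma sorted_pairP k n (I J : ksubset k n) :
  reflect (interlaced (val I) (val J) \/ interlaced (val J) (val I))
    (sorted_pair I J).
Proof.
apply: (iffP eqP) => [/setP e|].
  have hI : val I \in [set Sort1 I J; Sort2 I J] by rewrite -e set21.
  have hJ : val J \in [set Sort1 I J; Sort2 I J] by rewrite -e set22.
  have : Sort1 I J \in [set val I; val J] by rewrite e set21.
  have : Sort2 I J \in [set val I; val J] by rewrite e set22.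
  have b1 := @below_Sort1 _ _ I J; have b2 := @below_Sort2 _ _ I J.
  have upperI S T : val I = S -> val J = T ->
      (forall j, j <= n -> below S j = uphalf (below (val I) j + below (val J) j)) ->
      (forall j, j <= n -> below T j = (below (val I) j + below (val J) j)./2) ->
      interlaced (val I) (val J).
    by move=> <- <- u v j jn; have := u j jn; have := v j jn; lia.
  have upperJ S T : val I = S -> val J = T ->
      (forall j, j <= n -> below T j = uphalf (below (val I) j + below (val J) j)) ->
      (forall j, j <= n -> below S j = (below (val I) j + below (val J) j)./2) ->
      interlaced (val J) (val I).
    by move=> <- <- u v j jn; have := u j jn; have := v j jn; lia.
  (* If I and J are the same one of the two sorted sets, the other one coincides with it too,
     because it lies in {I, J}. *)
  move: hI hJ; rewrite !inE => /orP[] /eqP eI /orP[] /eqP eJ.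
  - move=> S2 _; have {S2} e2 : Sort2 I J = Sort1 I J.
      by move: S2; rewrite eI eJ orbb => /eqP.
    by left; apply: (upperI _ _ eI eJ b1); rewrite -e2.
  - by move=> _ _; left; apply: (upperI _ _ eI eJ).
  - by move=> _ _; right; apply: (upperJ _ _ eI eJ).
  - move=> _ S1; have {S1} e2 : Sort1 I J = Sort2 I J.
      by move: S1; rewrite eI eJ orbb => /eqP.
    by left; apply: (upperI _ _ eI eJ) => //; rewrite -e2.
case=> h.
  congr [set _; _]; apply: below_inj => j jn; rewrite ?below_Sort1 ?below_Sort2 //.
    by have := h j jn; lia.
  by have := h j jn; lia.
rewrite setUC; congr [set _; _]; apply: below_inj => j jn.
  by rewrite below_Sort1 //; have := h j jn; lia.
by rewrite below_Sort2 //; have := h j jn; lia.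
Qed.

Local Open Scope ring_scope.

(** * Three-term Pluecker relations *)

Lemma det_mx22E (R : comPzRingType) (M : 'M[R]_2) :
  \det M = M 0 0 * M 1 1 - M 0 1 * M 1 0.
Proof.
rewrite (expand_det_row _ 0) !big_ord_recl big_ord0 /cofactor !det_mx11 !mxE /=.
rewrite addr0 mul1r expr1 mulN1r mulrN.
by congr (_ * M _ _ - M _ _ * M _ _); apply: val_inj.
Qed.

Lemma det_replace_rows (R : comPzRingType) m (a b u v : 'rV[R]_(1 + 1 + m))
    (S : 'M[R]_(m, 1 + 1 + m)) :
  let M := col_mx (col_mx a b) S in
  \det (col_mx (col_mx (u *m M) (v *m M)) S) =
    (u 0 (lshift m 0) * v 0 (lshift m 1) - u 0 (lshift m 1) * v 0 (lshift m 0)) *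
    \det M.
Proof.
move=> M; pose P := col_mx (lsubmx u) (lsubmx v).
pose Q := col_mx (rsubmx u) (rsubmx v).
have -> : col_mx (col_mx (u *m M) (v *m M)) S = block_mx P Q 0 1%:M *m M.
  rewrite mul_block_col mul0mx mul1mx add0r; congr col_mx.
  by rewrite -[u in LHS]hsubmxK -[v in LHS]hsubmxK !mul_row_col !mul_col_mx -add_col_mx.
rewrite det_mulmx det_ublock det1 mulr1; congr (_ * _).
have P0 j : P 0 j = u 0 (lshift m j).
  by have -> : (0 : 'I_(1 + 1)) = lshift 1 0; [apply: val_inj | rewrite col_mxEu mxE].
have P1 j : P 1 j = v 0 (lshift m j).
  by have -> : (1 : 'I_(1 + 1)) = rshift 1 0; [apply: val_inj | rewrite col_mxEd mxE].
by rewrite det_mx22E !P0 !P1.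
Qed.

(** As [B a b] is nonzero, the rows of M form a basis. In coordinates with respect to it every B is
    a 2 x 2 minor times det M, and a polynomial identity remains. *)
Lemma three_term_rows (F : fieldType) m (a b c d : 'rV[F]_(1 + 1 + m))
    (S : 'M[F]_(m, 1 + 1 + m)) :
  let B u v := \det (col_mx (col_mx u v) S) in
  B a b != 0 -> B a c * B b d = B a b * B c d + B a d * B b c.
Proof.
move=> B Bab; pose M := col_mx (col_mx a b) S.
have Mu : M \in unitmx by rewrite unitmxE unitfE.
pose e (i : 'I_(1 + 1)) : 'rV[F]_(1 + 1 + m) := delta_mx 0 (lshift m i).
have ea : a = e 0 *m M.
  rewrite -rowE rowKu; have -> : (0 : 'I_(1 + 1)) = lshift 1 0 by apply: val_inj.
  by rewrite rowKu row_id.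
have eb : b = e 1 *m M.
  rewrite -rowE rowKu; have -> : (1 : 'I_(1 + 1)) = rshift 1 0 by apply: val_inj.
  by rewrite rowKd row_id.
have coord (v : 'rV_(1 + 1 + m)) : v = (v *m invmx M) *m M by rewrite mulmxKV.
have BE u v : B (u *m M) (v *m M) =
  (u 0 (lshift m 0) * v 0 (lshift m 1) - u 0 (lshift m 1) * v 0 (lshift m 0)) * \det M.
  exact: det_replace_rows.
have eE i j : e i 0 (lshift m j) = (j == i)%:R.
  by rewrite mxE eqxx /= (inj_eq (@lshift_inj _ _)).
have Ba w : B a (w *m M) = w 0 (lshift m 1) * \det M.
  by rewrite [X in B X _ = _]ea BE !eE /=; ring.
have Bb w : B b (w *m M) = - w 0 (lshift m 0) * \det M.
  by rewrite [X in B X _ = _]eb BE !eE /=; ring.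
rewrite (coord c) (coord d) !Ba !Bb BE -[\det M]/(B a b).
ring.
Qed.

(** The columns come as a sequence in any order, so that the signs of reorderings can be followed;
    [nth] pads a short sequence with zeros. *)
Definition column_minor (R : comNzRingType) k n (A : 'M[R]_(k, n)) (s : seq 'I_n) : R :=
  \det (\matrix_(i < k, j < k) nth 0 [seq A i x | x <- s] j).

Lemma three_term_column_minor (F : fieldType) k n (A : 'M[F]_(k, n)) a b c d s :
  (size s).+2 = k -> column_minor A [:: a, b & s] != 0 ->
  column_minor A [:: a, c & s] * column_minor A [:: b, d & s] =
    column_minor A [:: a, b & s] * column_minor A [:: c, d & s] +
    column_minor A [:: a, d & s] * column_minor A [:: b, c & s].
Proof.
move=> sk; case: _ / sk A => A; set m := size s.
pose r x : 'rV[F]_(1 + 1 + m) := \row_i A i x.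
pose S : 'M[F]_(m, 1 + 1 + m) := \matrix_(j, i) nth 0 [seq A i x | x <- s] j.
have cE x y : column_minor A [:: x, y & s] = \det (col_mx (col_mx (r x) (r y)) S).
  rewrite /column_minor -det_tr; congr determinant; apply/matrixP=> i j; rewrite !mxE.
  case: splitP => i' ->; rewrite !mxE //.
  by case: splitP => i'' ->; rewrite !mxE [i'']ord1.
by rewrite !cE; apply: three_term_rows.
Qed.

Lemma nth_swap (T : Type) (x0 x y : T) s t i :
  nth x0 (s ++ y :: x :: t) i =
  nth x0 (s ++ x :: y :: t)
    (if i == size s then (size s).+1 else if i == (size s).+1 then size s else i).
Proof.
rewrite !nth_cat; case: (ltngtP i (size s)) => [lt|gt|->].
- by rewrite ltn_eqF ?lt // ltnW.
- case: eqP => [->|ne]; first by rewrite ltnn subSnn subnn.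
  rewrite ltnNge (ltnW gt) /=.
  by have -> : (i - size s = (i - (size s).+2).+2)%N by lia.
- by rewrite ltnNge leqnSn subnn subSnn.
Qed.

Lemma column_minor_swap (R : comNzRingType) k n (A : 'M[R]_(k, n)) x y s t :
  size (s ++ x :: y :: t) = k ->
  column_minor A (s ++ y :: x :: t) = - column_minor A (s ++ x :: y :: t).
Proof.
rewrite size_cat /= => sk.
have s0 : (size s < k)%N by lia.
have s1 : ((size s).+1 < k)%N by lia.
pose i0 := Ordinal s0; pose i1 := Ordinal s1.
have ne : i0 != i1 by rewrite -val_eqE /= neq_ltn leqnn.
rewrite /column_minor; set M := \matrix_(_, _) nth 0 [seq _ | x <- s ++ x :: _] _.
have -> : (\matrix_(i < k, j < k) nth 0 [seq A i x | x <- s ++ y :: x :: t] j) =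
          col_perm (tperm i0 i1) M.
  apply/matrixP=> i j; rewrite !mxE !map_cat /= nth_swap size_map.
  congr nth; case: tpermP => [->|->|/eqP ne0 /eqP ne1] /=.
  - by rewrite eqxx.
  - by rewrite (gtn_eqF (leqnn _)) eqxx.
  - by rewrite -val_eqE /= in ne0; rewrite -val_eqE /= in ne1; rewrite (negPf ne0) (negPf ne1).
by rewrite col_permE det_mulmx det_perm tpermV odd_tperm ne expr1 mulrN1.
Qed.

(** Carrying x to the left past s takes [size s] adjacent swaps. *)
Lemma column_minor_move (R : comNzRingType) k n (A : 'M[R]_(k, n)) x p s t :
  size (p ++ s ++ x :: t) = k ->
  column_minor A (p ++ s ++ x :: t) = (-1) ^+ size s * column_minor A (p ++ x :: s ++ t).
Proof.
elim: s p => [|y s IHs] p /=; first by rewrite mul1r.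
move=> sk; have := IHs (rcons p y); rewrite !cat_rcons => -> //.
rewrite exprS mulN1r mulNr -mulrN; congr (_ * _).
rewrite column_minor_swap ?opprK //.
by rewrite -sk !size_cat /= !size_cat /=; lia.
Qed.

Lemma enum_setU1 n (K : {set 'I_n}) x : x \notin K -> exists s t,
  [/\ enum K = s ++ t, enum (x |: K) = s ++ x :: t & size s = below K x].
Proof.
move=> xK; have xin : x \in enum (x |: K) by rewrite mem_enum setU11.
case/splitPr: {-1}_ / (xin) (erefl (enum (x |: K))) => s t exK.
have := enum_uniq (x |: K); rewrite -[enum _]/(enum (x |: K)) exK => u.
have := enum_set_sorted (x |: K); rewrite exK sorted_map => so.
exists s, t; split=> //.
  apply: (@irr_sorted_eq _ (relpre val ltn)).
  - by move=> y z w /=; apply: ltn_trans.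
  - by move=> y /=; rewrite ltnn.
  - by have := enum_set_sorted K; rewrite sorted_map.
  - apply: subseq_sorted so; first by move=> y z w /=; apply: ltn_trans.
    by apply: cat_subseq => //; apply: subseq_cons.
  move=> y; rewrite mem_enum mem_cat.
  have : y \in s ++ x :: t = (y \in x |: K) by rewrite -exK mem_enum.
  rewrite mem_cat !inE; have [->|//] := eqVneq y x.
  move: u; rewrite (negPf xK) cat_uniq /= negb_or => /and4P[_ /andP[xs _] xt _] _.
  by rewrite (negPf xs) (negPf xt).
have ss : (size s < #|x |: K|)%N by rewrite cardE exK size_cat /= addnS ltnS leq_addr.
have := below_nth x ss; rewrite exK nth_cat ltnn subnn /= => <-.
rewrite /below; congr #|pred_of_set _|; apply/setP=> y; rewrite !inE.
by have [->|] := eqVneq y x; rewrite ?ltnn ?andbF.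
Qed.

Definition set_minor (R : comNzRingType) k n (A : 'M[R]_(k, n)) (S : {set 'I_n}) : R :=
  column_minor A (enum S).

(** Column a is brought to the front, then b to the second place. The sign is a factor for a times a
    factor for b, so the three products of a three-term relation all carry the same sign. *)
Lemma set_minor_pair (R : comNzRingType) k n (A : 'M[R]_(k, n)) (K : {set 'I_n}) (a b : 'I_n) :
  (a < b)%N -> a \notin K -> b \notin K -> #|K|.+2 = k ->
  set_minor A ([set a; b] :|: K) =
    (-1) ^+ (below K a + below K b) * column_minor A [:: a, b & enum K].
Proof.
move=> ab aK bK Kk; have aK' : a \notin b |: K.
  by rewrite !inE negb_or aK andbT -val_eqE neq_ltn ab.
have [s [t [E1 E2 szs]]] := enum_setU1 aK'.
have [s' [t' [E1' E2' szs']]] := enum_setU1 bK.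
have szK : (size s' + size t').+2 = k by rewrite -size_cat -E1' -cardE.
have szbK : (size s + size t).+1 = k.
  by rewrite -size_cat -E1 -cardE cardsU1 bK.
rewrite /set_minor -setUA E2 (column_minor_move A (p := [::])); last first.
  by rewrite /= size_cat /= addnS.
rewrite /= -E1 E2' (column_minor_move A (p := [:: a])) /=; last first.
  by rewrite /= size_cat /= addnS.
rewrite -E1' mulrA -exprD szs szs'; congr ((-1) ^+ (_ + _) * _).
rewrite /below; congr #|pred_of_set _|; apply/setP=> y; rewrite !inE.
by have [->|_] := eqVneq y b; rewrite //= ltnNge (ltnW ab) andbF.
Qed.

(** * Exchange inequalities from crossing pairs *)

(** Seen as chords of a circle, ac and bd cross, while ab, cd and ad, bc do not. The function f is
    arbitrary so that it can also be a minor composed with a rotation. *)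
Definition crossing_dominates (R : realDomainType) k n (f : {set 'I_n} -> R) : Prop :=
  forall (K : {set 'I_n}) (a b c d : 'I_n), #|K|.+2 = k ->
  a \notin K -> b \notin K -> c \notin K -> d \notin K -> (a < b < c)%N -> (c < d)%N ->
  f ([set a; b] :|: K) * f ([set c; d] :|: K) <
    f ([set a; c] :|: K) * f ([set b; d] :|: K) /\
  f ([set a; d] :|: K) * f ([set b; c] :|: K) <
    f ([set a; c] :|: K) * f ([set b; d] :|: K).

(** The three-term relation writes the crossing product as the sum of the other two products, both
    positive. *)
Lemma set_minor_crossing (R : realFieldType) k n (A : 'M[R]_(k, n)) :
  (forall S : {set 'I_n}, #|S| = k -> 0 < set_minor A S) ->
  crossing_dominates k (set_minor A).
Proof.
move=> pos K a b c d Kk aK bK cK dK /andP[ab bc] cd.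
have pos2 (x y : 'I_n) : (x < y)%N -> x \notin K -> y \notin K -> 0 < set_minor A ([set x; y] :|: K).
  move=> xy xK yK; apply: pos; rewrite -setUA !cardsU1 !inE negb_or xK yK.
  by rewrite andbT -val_eqE neq_ltn xy.
have ac := ltn_trans ab bc; have bd := ltn_trans bc cd; have ad := ltn_trans ab bd.
suff E : set_minor A ([set a; c] :|: K) * set_minor A ([set b; d] :|: K) =
    set_minor A ([set a; b] :|: K) * set_minor A ([set c; d] :|: K) +
    set_minor A ([set a; d] :|: K) * set_minor A ([set b; c] :|: K).
  by rewrite E ltrDl ltrDr !mulr_gt0 ?pos2.
have nz : column_minor A [:: a, b & enum K] != 0.
  have := pos2 a b ab aK bK; rewrite set_minor_pair //.
  by apply: contraTneq => ->; rewrite mulr0 ltxx.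
have szK : (size (enum K)).+2 = k by rewrite -cardE.
rewrite !set_minor_pair // !exprD.
have := three_term_column_minor c d szK nz.
set u := column_minor A _; set v := column_minor A _; set w := column_minor A _.
set x := column_minor A _; set y := column_minor A _; set z := column_minor A _.
by move=> h; ring: h.
Qed.

(** Multiply the two inequalities and cancel b d. *)
Lemma lt_cross_mul (R : realFieldType) (a b c d e g : R) : 0 < a -> 0 < b -> 0 < d -> 0 < e ->
  a * b < c * d -> d * e < b * g -> a * e < c * g.
Proof.
move=> a0 b0 d0 e0 h1 h2; rewrite -(ltr_pM2r (mulr_gt0 b0 d0)).
rewrite [ltLHS](_ : _ = (a * b) * (d * e)); last by ring.
rewrite [ltRHS](_ : _ = (c * d) * (b * g)); last by ring.
by apply: ltr_pM => //; apply/ltW/mulr_gt0.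
Qed.

(** By the cell inequalities the ratio of [Z i.+1 j] to [Z i j] decreases in j. Chaining in j
    compares the ends of one strip; chaining the strips in i reaches the four corners. *)
Lemma grid_corners_lt (R : realFieldType) (Z : nat -> nat -> R) p q : (0 < p)%N -> (0 < q)%N ->
  (forall i j, (i <= p)%N -> (j <= q)%N -> 0 < Z i j) ->
  (forall i j, (i < p)%N -> (j < q)%N -> Z i j * Z i.+1 j.+1 < Z i.+1 j * Z i j.+1) ->
  Z 0%N 0%N * Z p q < Z p 0%N * Z 0%N q.
Proof.
move=> p0 q0 pos cell.
have row i j : (i < p)%N -> (j < q)%N -> Z i 0%N * Z i.+1 j.+1 < Z i.+1 0%N * Z i j.+1.
  move=> ip; elim: j => [|j IHj] jq; first exact: cell.
  apply: lt_cross_mul (IHj (ltnW jq)) (cell _ _ ip jq); apply: pos => //; lia.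
have col i : (i < p)%N -> Z 0%N 0%N * Z i.+1 q < Z i.+1 0%N * Z 0%N q.
  elim: i => [|i IHi] ip; first by case: q q0 pos cell row => // q _ _ _ row; apply: row.
  have := row i.+1 q.-1 ip; rewrite prednK // => /(_ (leqnn _)) h.
  rewrite [ltRHS]mulrC; have := IHi (ltnW ip); rewrite [ltRHS]mulrC => h'.
  rewrite [ltRHS]mulrC in h; apply: lt_cross_mul h' h; apply: pos => //; lia.
by have := col p.-1; rewrite prednK // => /(_ (leqnn _)).
Qed.

(** On (x, y] the set X has counted at least i + 1 elements and Y at most i. Were y smaller than x,
    Y would overtake X just after y. *)
Lemma dominated_nth_enum n (X Y : {set 'I_n}) x0 i :
  #|X| = #|Y| -> [disjoint X & Y] ->
  (forall j, (j <= n)%N -> (below Y j <= below X j)%N) -> (i < #|X|)%N ->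
  let x := nth x0 (enum X) i in let y := nth x0 (enum Y) i in
  (x < y)%N /\ forall z, (x < z <= y)%N -> (below Y z < below X z)%N.
Proof.
move=> XY dXY le iX x y; have iY : (i < #|Y|)%N by rewrite -XY.
have xX : x \in X by rewrite -mem_enum mem_nth -?cardE.
have yY : y \in Y by rewrite -mem_enum mem_nth -?cardE.
have bx : below X x = i by apply: below_nth.
have bY : below Y y = i by apply: below_nth.
have bx1 : below X x.+1 = i.+1 by rewrite belowS bx xX addn1.
have by1 : below Y y.+1 = i.+1 by rewrite belowS bY yY addn1.
split; last first.
  move=> z /andP[xz zy]; have := below_mono X xz; have := below_mono Y zy; lia.
rewrite ltnNge leq_eqVlt; apply/norP; split.
  by apply/eqP=> /val_inj yx; move: (disjointFl dXY yY); rewrite yx xX.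
apply/negP=> yx; have := le _ (ltn_ord y); have := below_mono X yx; lia.
Qed.

(** X1 is matched with Y1, and X2 with Y2, by rank, and one matched pair is exchanged at a time. The
    partial exchanges form a grid whose cells are crossing inequalities and whose corners are the
    four sets of the claim. *)
Lemma swap_dominated_lt (R : realFieldType) k n (f : {set 'I_n} -> R)
    (X1 Y1 X2 Y2 K : {set 'I_n}) :
  crossing_dominates k f -> (forall S : {set 'I_n}, #|S| = k -> 0 < f S) ->
  uniq (enum X1 ++ enum Y1 ++ enum X2 ++ enum Y2 ++ enum K) ->
  (#|X1| + #|X2| + #|K|)%N = k -> #|X1| = #|Y1| -> #|X2| = #|Y2| ->
  (0 < #|X1|)%N -> (0 < #|X2|)%N ->
  (forall j, (j <= n)%N -> (below Y1 j <= below X1 j)%N) ->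
  (forall j, (j <= n)%N -> (below X2 j <= below Y2 j)%N) ->
  (forall j, (j <= n)%N ->
     below Y1 j = below X1 j \/ below X2 j = below Y2 j) ->
  f (X1 :|: X2 :|: K) * f (Y1 :|: Y2 :|: K) <
    f (Y1 :|: X2 :|: K) * f (X1 :|: Y2 :|: K).
Proof.
move=> fcross fpos u sz c1 c2 p1 p2 le1 le2 excl.
have d1 : [disjoint X1 & Y1].
  rewrite disjoint_subset; apply/subsetP=> z zX; rewrite inE; apply: contraL u => zY.
  rewrite catA cat_uniq; apply/nandP; left; rewrite cat_uniq; apply/and3P=> -[_ /hasPn h _].
  by have := h z; rewrite !mem_enum zY zX => /(_ isT).
have d2 : [disjoint Y2 & X2].
  rewrite disjoint_subset; apply/subsetP=> z zY; rewrite inE; apply: contraL u => zX.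
  rewrite catA cat_uniq; apply/and3P=> -[_ _]; rewrite catA cat_uniq => /andP[].
  rewrite cat_uniq => /and3P[_ /hasPn h _] _.
  by have := h z; rewrite !mem_enum zY zX => /(_ isT).
have [x0 _] : exists x, x \in X1 by apply/set0Pn; rewrite -card_gt0.
(* [L i j] lists the set after i exchanges between X1 and Y1 and j exchanges between X2 and Y2. *)
pose L i j := drop i (enum X1) ++ take i (enum Y1) ++
              drop j (enum X2) ++ take j (enum Y2) ++ enum K.
pose Z i j := f [set x in L i j].
have subL i i' j j' : subseq (drop i (enum X1) ++ take i' (enum Y1) ++
    drop j (enum X2) ++ take j' (enum Y2) ++ enum K)
    (enum X1 ++ enum Y1 ++ enum X2 ++ enum Y2 ++ enum K).
  by do ?apply: cat_subseq; rewrite ?drop_subseq ?take_subseq.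
have szL i j : (i <= #|X1|)%N -> (j <= #|X2|)%N -> size (L i j) = k.
  move=> iX jX; rewrite !size_cat !size_drop !size_takel -?cardE -?c1 -?c2 // -sz.
  lia.
have Zpos i j : (i <= #|X1|)%N -> (j <= #|X2|)%N -> 0 < Z i j.
  move=> iX jX; apply: fpos; rewrite cardsE (card_uniqP _) ?szL //.
  exact: subseq_uniq (subL _ _ _ _) u.
have cell i j : (i < #|X1|)%N -> (j < #|X2|)%N ->
    Z i j * Z i.+1 j.+1 < Z i.+1 j * Z i j.+1.
  move=> iX jX; set x := nth x0 (enum X1) i; set y := nth x0 (enum Y1) i.
  set x' := nth x0 (enum X2) j; set y' := nth x0 (enum Y2) j.
  (* M is the common part of the four sets of a cell. *)
  pose M := drop i.+1 (enum X1) ++ take i (enum Y1) ++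
              drop j.+1 (enum X2) ++ take j (enum Y2) ++ enum K.
  have dX1 : drop i (enum X1) = x :: drop i.+1 (enum X1) by apply: drop_nth; rewrite -cardE.
  have dX2 : drop j (enum X2) = x' :: drop j.+1 (enum X2) by apply: drop_nth; rewrite -cardE.
  have tY1 : take i.+1 (enum Y1) = rcons (take i (enum Y1)) y.
    by apply: take_nth; rewrite -cardE -c1.
  have tY2 : take j.+1 (enum Y2) = rcons (take j (enum Y2)) y'.
    by apply: take_nth; rewrite -cardE -c2.
  have : uniq [:: x, y, x', y' & M].
    rewrite -(perm_uniq (_ : perm_eq (drop i (enum X1) ++ take i.+1 (enum Y1) ++
      drop j (enum X2) ++ take j.+1 (enum Y2) ++ enum K) _)).
      exact: subseq_uniq (subL _ _ _ _) u.
    rewrite dX1 dX2 tY1 tY2; apply/seq.permP=> P.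
    by rewrite /M -!cats1 /= !count_cat /= !count_cat /=; lia.
  rewrite /= !inE !negb_or -!andbA.
  case/and5P=> _ nxx' _ xM /and5P[_ nyy' yM _ /and3P[x'M y'M uM]].
  pose KM := [set z in M].
  have notin z : z \notin M -> z \notin KM by rewrite inE.
  move: xM yM x'M y'M => /notin xM /notin yM /notin x'M /notin y'M.
  have cKM : #|KM|.+2 = k.
    rewrite cardsE (card_uniqP uM) -(szL i j (ltnW iX) (ltnW jX)) /M /L dX1 dX2.
    by rewrite !size_cat /=; clear; lia.
  have ZE00 : Z i j = f ([set x; x'] :|: KM).
    congr f; apply/setP=> z; rewrite !inE /L dX1 dX2 !(mem_cat, inE).
    by move: (z \in _) (z \in _) (z \in _) (z \in _) (z \in _) (z == _) (z == _);
       do 7!case.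
  have ZE11 : Z i.+1 j.+1 = f ([set y; y'] :|: KM).
    congr f; apply/setP=> z; rewrite !inE /L tY1 tY2 !(mem_cat, mem_rcons, inE).
    by move: (z \in _) (z \in _) (z \in _) (z \in _) (z \in _) (z == _) (z == _);
       do 7!case.
  have ZE10 : Z i.+1 j = f ([set y; x'] :|: KM).
    congr f; apply/setP=> z; rewrite !inE /L tY1 dX2 !(mem_cat, mem_rcons, inE).
    by move: (z \in _) (z \in _) (z \in _) (z \in _) (z \in _) (z == _) (z == _);
       do 7!case.
  have ZE01 : Z i j.+1 = f ([set x; y'] :|: KM).
    congr f; apply/setP=> z; rewrite !inE /L dX1 tY2 !(mem_cat, mem_rcons, inE).
    by move: (z \in _) (z \in _) (z \in _) (z \in _) (z \in _) (z == _) (z == _);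
       do 7!case.
  rewrite ZE00 ZE11 ZE10 ZE01.
  have [xy gap1] := dominated_nth_enum x0 c1 d1 le1 iX.
  have [] := @dominated_nth_enum _ Y2 X2 x0 j _ d2 le2 _; rewrite -?c2 // => y'x' gap2.
  rewrite -/x -/y in xy gap1; rewrite -/x' -/y' in y'x' gap2.
  (* By [excl] the intervals (x, y] and (y', x'] are disjoint, so one lies to the left of the
     other. *)
  have excl' z : (z <= n)%N -> ~ ((x < z <= y)%N /\ (y' < z <= x')%N).
    by move=> zn [/gap1 h1 /gap2 h2]; move: h1 h2 (excl z zn); clear; lia.
  rewrite -!val_eqE /= in nxx' nyy'.
  have := excl' y (ltnW (ltn_ord y)); have := excl' x' (ltnW (ltn_ord x')) => e1 e2.
  (* Either x < y < y' < x' or y' < x' < x < y; in both orders the right-hand side is the crossing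
     product. *)
  case: (ltngtP y y') nyy' => // [yy' _|y'y _].
    have [_] := fcross KM x y y' x' cKM xM yM y'M x'M (introT andP (conj xy yy')) y'x'.
    by rewrite [ltRHS]mulrC.
  have x'x : (x' < x)%N by clear -xy y'x' nxx' y'y e1 e2; lia.
  have [_] := fcross KM y' x' x y cKM y'M x'M xM yM (introT andP (conj y'x' x'x)) xy.
  rewrite [[set y'; y]]setUC [[set x'; x]]setUC [[set y'; x]]setUC [[set x'; y]]setUC.
  by rewrite [ltLHS]mulrC [ltRHS]mulrC.
have := grid_corners_lt p1 p2 Zpos cell.
have szX1 : (size (enum X1) <= #|X1|)%N by rewrite cardE.
have szX2 : (size (enum X2) <= #|X2|)%N by rewrite cardE.
have szY1 : (size (enum Y1) <= #|X1|)%N by rewrite c1 cardE.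
have szY2 : (size (enum Y2) <= #|X2|)%N by rewrite c2 cardE.
rewrite /Z /L !take0 !drop0 !take_oversize // !drop_oversize //=.
have E3 (S T : {set 'I_n}) : [set x in enum S ++ enum T ++ enum K] = S :|: T :|: K.
  by apply/setP=> x; rewrite !inE !mem_cat !mem_enum orbA.
by rewrite !E3.
Qed.

Lemma cards_sum (T : finType) (A : {set T}) : #|A| = (\sum_x (x \in A))%N.
Proof. by rewrite -sum1_card big_mkcond. Qed.

(* Positions where the path [below S - below T] is above (below) its base level
   supply the pairs [X1], [Y1] ([X2], [Y2]); the swap reflects the part of the
   path above the base level. *)
Lemma swap_excursions_lt (R : realFieldType) k n (f : {set 'I_n} -> R) (S T : {set 'I_n}) s t :
  crossing_dominates k f -> (forall S : {set 'I_n}, #|S| = k -> 0 < f S) ->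
  #|S| = k -> #|T| = k -> (s <= n)%N -> (t <= n)%N ->
  (below T s < below S s)%N -> (below S t < below T t)%N ->
  exists S' T' : {set 'I_n}, [/\ #|S'| = k, #|T'| = k,
    forall x, ((x \in S) + (x \in T) = (x \in S') + (x \in T'))%N
    & f S * f T < f S' * f T'].
Proof.
move=> fcross fpos Sk Tk sn tn hs ht.
pose X1 := [set x in S :\: T | below T x <= below S x]%N.
pose Y1 := [set x in T :\: S | below T x < below S x]%N.
pose X2 := [set x in S :\: T | below S x < below T x]%N.
pose Y2 := [set x in T :\: S | below S x <= below T x]%N.
pose K := S :&: T.
(* Truncated subtraction yields positive parts: X1 exceeds Y1 by the height of the path above 0, and
   Y2 exceeds X2 by its depth below 0. Domination, equal sizes and exclusivity follow. *)
have count1 j : (j <= n)%N ->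
    below X1 j = (below Y1 j + (below S j - below T j))%N /\
    below Y2 j = (below X2 j + (below T j - below S j))%N.
  elim: j => [|j IHj] jn; first by rewrite !below0.
  have [h1 h2] := IHj (ltnW jn); have BS U := belowS U (Ordinal jn).
  rewrite /= in BS; rewrite !BS !inE /=.
  by case: (_ \in S); case: (_ \in T) => /=; lia.
have SE : X1 :|: X2 :|: K = S.
  by apply/setP=> x; rewrite !inE; case: (x \in S); case: (x \in T) => //=; lia.
have TE : Y1 :|: Y2 :|: K = T.
  by apply/setP=> x; rewrite !inE; case: (x \in S); case: (x \in T) => //=; lia.
have dis x : ((x \in X1) + (x \in Y1) + (x \in X2) + (x \in Y2) + (x \in K) <= 1)%N.
  by rewrite !inE; case: (x \in S); case: (x \in T) => //=; lia.
have u : uniq (enum X1 ++ enum Y1 ++ enum X2 ++ enum Y2 ++ enum K).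
  rewrite !cat_uniq !enum_uniq /= !andbT; apply/and4P; split; apply/hasPn=> x;
  by rewrite /= ?mem_cat !mem_enum; have := dis x; do 5!case: (x \in _).
have [c1 c2] := count1 n (leqnn _); rewrite !below_full Sk Tk subnn !addn0 in c1 c2.
have p1 : (0 < #|X1|)%N.
  by rewrite -below_full; have := below_mono X1 sn; have [] := count1 s sn; lia.
have p2 : (0 < #|Y2|)%N.
  by rewrite -below_full; have := below_mono Y2 tn; have [] := count1 t tn; lia.
have card3 (A B C : {set 'I_n}) : (forall x, (x \in A) + (x \in B) + (x \in C) <= 1)%N ->
    #|A :|: B :|: C| = (#|A| + #|B| + #|C|)%N.
  move=> ABC; rewrite !cards_sum -!big_split /=; apply: eq_bigr => x _.
  by have := ABC x; rewrite !inE; do 3!case: (x \in _).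
have sz : (#|X1| + #|X2| + #|K|)%N = k.
  rewrite -Sk -SE -!card3 // => x; have := dis x; lia.
exists (Y1 :|: X2 :|: K), (X1 :|: Y2 :|: K); split.
- by rewrite card3 -?c1 // => x; have := dis x; lia.
- by rewrite card3 ?c2 // => x; have := dis x; lia.
- move=> x; rewrite -{1}SE -{1}TE !in_setU.
  by have := dis x; do 5!case: (x \in _).
have := @swap_dominated_lt _ k n f X1 Y1 X2 Y2 K fcross fpos u sz c1 (esym c2) p1 .
rewrite SE TE; apply; rewrite -?c2 // => j jn; have [] := count1 j jn; lia.
Qed.

(** * Cyclic rotation of the ground set *)

Lemma rotate_subproof n t (x : 'I_n) : ((x + t) %% n < n)%N.
Proof. by rewrite ltn_mod (leq_ltn_trans (leq0n x)). Qed.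

Definition rotate n t (x : 'I_n) : 'I_n := Ordinal (rotate_subproof t x).

Lemma rotateE n t (x : 'I_n) : (t <= n)%N ->
  rotate t x = (if x + t < n then x + t else x + t - n)%N :> nat.
Proof.
move=> tn /=; have xn := ltn_ord x; case: ltnP => h; first by rewrite modn_small.
by rewrite -[in LHS](subnK h) modnDr modn_small //; lia.
Qed.

Lemma rotate_inj n t : (t <= n)%N -> injective (@rotate n t).
Proof.
move=> tn x y /(congr1 val); rewrite ![val _]rotateE // => e; apply: val_inj => /=.
have xn := ltn_ord x; have yn := ltn_ord y.
by move: e; do 2!case: ltnP => ?; lia.
Qed.

Lemma imset_rotateK n t (S : {set 'I_n}) : (t <= n)%N ->
  rotate t @: (rotate t @^-1: S) = S.
Proof.
move=> tn; apply/setP=> x; apply/imsetP/idP => [[y]|xS]; first by rewrite inE => + ->.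
have e := permKV (perm (rotate_inj tn)) x; rewrite permE in e.
by exists ((perm (rotate_inj tn))^-1%g x); rewrite // inE e.
Qed.

(** The path of the preimage is the path of S read from t on; past n it continues one period higher,
    by [#|S|]. The term [below S t] stands on the left to avoid truncated subtraction. *)
Lemma below_preim_rotate n t (S : {set 'I_n}) j : (t <= n)%N -> (j <= n)%N ->
  (below (rotate t @^-1: S) j + below S t =
   if t + j <= n then below S (t + j) else #|S| + below S (t + j - n))%N.
Proof.
move=> tn; elim: j => [|j IHj] jn; first by rewrite below0 addn0 tn.
have e := IHj (ltnW jn).
have r : rotate t (Ordinal jn) = (if j + t < n then j + t else j + t - n)%N :> nat.
  exact: (rotateE (Ordinal jn) tn).
have bE := belowS S (rotate t (Ordinal jn)); rewrite r in bE.
have -> := belowS (rotate t @^-1: S) (Ordinal jn); rewrite inE /= addnAC e.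
move: bE; rewrite [(t + j)%N]addnC [(t + j.+1)%N]addnC addSn.
case: ltnP => h bE; first by rewrite (ltnW h) bE.
rewrite subSn // bE; case: leqP => h'; last by rewrite addnA.
have -> : (j + t = n)%N by lia.
by rewrite subnn below0 below_full.
Qed.

(** Rotation keeps the cyclic order of a, b, c, d and hence the crossing pairs. The elements that
    wrap around form a final segment of a < b < c < d, which gives five cases. *)
Lemma crossing_dominates_rotate (R : realDomainType) k n (f : {set 'I_n} -> R) t :
  (t <= n)%N -> crossing_dominates k f ->
  crossing_dominates k (fun S : {set 'I_n} => f (rotate t @: S)).
Proof.
move=> tn fc K a b c d cK aK bK cK' dK /andP[ab bc] cd.
pose r := @rotate n t; have rK x : x \notin K -> r x \notin r @: K.
  by rewrite mem_imset //; apply: rotate_inj.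
have im x y : r @: ([set x; y] :|: K) = [set r x; r y] :|: r @: K.
  by rewrite imsetU imsetU1 imset_set1.
have crK : #|r @: K|.+2 = k by rewrite card_imset //; apply: rotate_inj.
rewrite -/r !im; pose g x y := f ([set r x; r y] :|: r @: K).
have gC x y : g x y = g y x by rewrite /g [[set r x; r y]]setUC.
have {}fc (x y z w : 'I_n) : x \notin K -> y \notin K -> z \notin K -> w \notin K ->
    (r x < r y)%N -> (r y < r z)%N -> (r z < r w)%N ->
    g x y * g z w < g x z * g y w /\ g x w * g y z < g x z * g y w.
  by move=> xK yK zK wK xy yz zw; apply: fc; rewrite ?rK // xy yz.
rewrite -!/(g _ _).
have E (x : 'I_n) : (x + t < n /\ (r x = x + t :> nat) \/ n <= x + t /\ (r x = x + t - n :> nat))%N.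
  by have := rotateE x tn; rewrite -/r; case: ltnP; [left | right].
have {E} [Ea Eb Ec Ed] := And4 (E a) (E b) (E c) (E d).
have an := ltn_ord a; have bn := ltn_ord b; have cn := ltn_ord c; have dn := ltn_ord d.
have [d1|d1] := ltnP (d + t) n.
  by apply: fc => //; lia.
have [c1|c1] := ltnP (c + t) n.
  have [] := fc d a b c dK aK bK cK' _ _ _; try lia.
  by rewrite (gC d a) (gC d b) (gC d c) => *; split; lra.
have [b1|b1] := ltnP (b + t) n.
  have [] := fc c d a b cK' dK aK bK _ _ _; try lia.
  by rewrite (gC c a) (gC d b) (gC c b) (gC d a) => *; split; lra.
have [a1|a1] := ltnP (a + t) n.
  have [] := fc b c d a bK cK' dK aK _ _ _; try lia.
  by rewrite (gC d a) (gC c a) (gC b a) => *; split; lra.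
by apply: fc => //; lia.
Qed.

(** Discrete intermediate values: with steps of at most 1, a path that misses the level l stays on
    one side of it. *)
Lemma path_hits_level (D : nat -> int) m s t (l : int) : (s <= m)%N -> (t <= m)%N ->
  (forall j, (j < m)%N -> `|D j.+1 - D j| <= 1) -> l < D s -> D t < l ->
  exists2 j, (j <= m)%N & D j = l.
Proof.
move=> sm tm step ls tl.
case: (boolP [exists j : 'I_m.+1, D j == l]) => [/existsP[j /eqP Dj]|/existsPn no].
  by exists j; rewrite // -ltnS.
have side j : (j <= m)%N -> (D j < l) = (D 0%N < l).
  elim: j => // j IHj jm; rewrite -(IHj (ltnW jm)).
  have := no (Ordinal (leqW jm)); have := no (Ordinal (jm : (j.+1 < m.+1)%N)).
  by have := step j jm => /=; lia.
by have := side s sm; have := side t tm; lia.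
Qed.

Lemma not_interlaced_lt (R : realFieldType) k n (f : {set 'I_n} -> R) (S T : {set 'I_n}) :
  crossing_dominates k f -> (forall S : {set 'I_n}, #|S| = k -> 0 < f S) ->
  #|S| = k -> #|T| = k -> ~ interlaced S T -> ~ interlaced T S ->
  exists S' T' : {set 'I_n}, [/\ #|S'| = k, #|T'| = k,
    forall x, ((x \in S) + (x \in T) = (x \in S') + (x \in T'))%N
    & f S * f T < f S' * f T'].
Proof.
move=> fcross fpos Sk Tk nST nTS.
have notI (U V : {set 'I_n}) : ~ interlaced U V ->
    exists2 j, (j <= n)%N & ~~ (below V j <= below U j <= (below V j).+1)%N.
  move=> nUV; case: (boolP [forall j : 'I_n.+1, (below V j <= below U j <= (below V j).+1)%N]).
    by move/forallP=> h; case: nUV => j jn; apply: (h (Ordinal (jn : (j < n.+1)%N))).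
  by move/forallPn=> [j hj]; exists j; rewrite // -ltnS.
pose D j : int := (below S j)%:Z - (below T j)%:Z.
have D0 : D 0%N = 0 by rewrite /D !below0.
have Dn : D n = 0 by rewrite /D !below_full Sk Tk subrr.
(* D leaves {0, 1} at some i and {-1, 0} at some j; comparing these values with each other or with D
   0 = 0 yields two that differ by at least 2. *)
have [s [t [sn tn Dst]]] : exists s t, [/\ (s <= n)%N, (t <= n)%N & D t + 2 <= D s].
  have [i ilen hi] := notI _ _ nST; have [j jlen hj] := notI _ _ nTS.
  have [h|h] := leP 2 (D i); first by exists i, 0%N; rewrite D0.
  have [h'|h'] := leP (D j) (- 2); first by exists 0%N, j; rewrite D0; split=> //; lia.
  by exists j, i; split=> //; rewrite /D in h h' *; lia.
have step j : (j < n)%N -> `|D j.+1 - D j| <= 1.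
  move=> jn; rewrite /D !(belowS _ (Ordinal jn)) /=.
  by do 2!case: (_ \in _); lia.
have lt_l : D t < D t + 1 by lia.
have l_lt : D t + 1 < D s by lia.
(* A place t0 on the level D t + 1, strictly between D t and D s, becomes the start of the rotated
   path. *)
have [t0 t0n Dt0] := path_hits_level sn tn step l_lt lt_l.
pose r := @rotate n t0.
have bU (U : {set 'I_n}) j (jn : (j <= n)%N) := below_preim_rotate U t0n jn.
have card_im (U : {set 'I_n}) : #|r @: U| = #|U| by apply/card_imset/rotate_inj.
have card_pre (U : {set 'I_n}) : #|r @^-1: U| = #|U| by rewrite -[LHS]card_im /r imset_rotateK.
(* The rotated path takes the values D j - D t0, so s yields a point above 0 and t a point below.
   Past n the offsets [#|S|] and [#|T|] cancel, both being k. *)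
have pull j : (j <= n)%N -> exists2 i, (i <= n)%N &
    (below (r @^-1: S) i)%:Z - (below (r @^-1: T) i)%:Z = D j - D t0.
  move=> jn; case: (leqP t0 j) => tj.
    exists (j - t0)%N; first lia.
    have jt : (j - t0 <= n)%N by lia.
    have := bU S _ jt; have := bU T _ jt; rewrite subnKC // jn -/r /D; lia.
  exists (j + n - t0)%N; first lia.
  have jt : (j + n - t0 <= n)%N by lia.
  have := bU S _ jt; have := bU T _ jt; rewrite subnKC; last by lia.
  rewrite -/r; case: ifP => jn'; last by rewrite addnK /D Sk Tk; lia.
  (* For j = 0 the rotated path has just reached n without wrapping, where D is 0 as well. *)
  have j0 : j = 0%N by lia.
  by rewrite j0 add0n !below_full /D !below0 Sk Tk; lia.
have [s' s'n hs] := pull s sn; have [t' t'n ht] := pull t tn.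
have [S' [T' [cS' cT' e lt]]] := @swap_excursions_lt _ k n (fun U : {set 'I_n} => f (r @: U))
  (r @^-1: S) (r @^-1: T) s' t' (crossing_dominates_rotate t0n fcross)
  (fun U Uk => fpos _ (etrans (card_im U) Uk)) (etrans (card_pre S) Sk)
  (etrans (card_pre T) Tk) s'n t'n ltac:(lia) ltac:(lia).
exists (r @: S'), (r @: T'); rewrite !card_im; split=> //; last first.
  by rewrite /r !imset_rotateK // in lt.
move=> x; have: x \in r @: (r @^-1: [set: 'I_n]) by rewrite /r imset_rotateK.
case/imsetP=> y _ ->; have := e y; rewrite !inE => ->.
by rewrite !mem_imset //; apply: rotate_inj.
Qed.

(** * Minors of an unsorted pair *)

Lemma minorE (R : realType) k n (A : 'M[R]_(k, n)) (I : ksubset k n) :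
  minor A I = set_minor A (val I).
Proof.
rewrite /minor /set_minor /column_minor; congr determinant; apply/matrixP=> i j.
rewrite !mxE; set y := cast_ord _ _; have jI : (j < size (enum (val I)))%N.
  by rewrite -cardE; have := ltn_ord y.
have [x0 _] : exists x0 : 'I_n, true by exists (enum_val y).
by rewrite (nth_map x0) // (enum_val_nth x0).
Qed.

(** Equality of the multiset unions is recorded as a linear relation between indicator vectors, the
    form to which affine independence applies. *)
Lemma unsorted_minor_lt (R : realType) k n (A : 'M[R]_(k, n)) (I J : ksubset k n) :
  positive_rep A -> ~~ sorted_pair I J ->
  exists I' J' : ksubset k n,
    eps R I + eps R J = eps R I' + eps R J' /\
    minor A I * minor A J < minor A I' * minor A J'.
Proof.
move=> [_ Apos] /sorted_pairP nIJ.
have pos (S : {set 'I_n}) : #|S| = k -> 0 < set_minor A S.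
  by move=> /eqP Sk; have := Apos (Sub S Sk); rewrite minorE.
have nI h := nIJ (or_introl h); have nJ h := nIJ (or_intror h).
have [S' [T' [/eqP cS' /eqP cT' e lt]]] := not_interlaced_lt (set_minor_crossing pos) pos
  (eqP (valP I)) (eqP (valP J)) nI nJ.
exists (Sub S' cS'), (Sub T' cT'); rewrite !minorE; split=> //.
by apply/rowP=> x; rewrite !mxE -!natrD; congr _%:R; apply: e.
Qed.

(** * Affine independence of sorted collections *)

(** Members of a sorted collection are pointwise comparable by [below], so the sum over j orders
    them: lying pointwise above without a larger sum forces equality. *)
Lemma interlaced_of_weight k n (C : {set ksubset k n}) (K L : ksubset k n) :
  sorted_collection C -> K \in C -> L \in C ->
  (\sum_(j < n.+1) below (val K) j <= \sum_(j < n.+1) below (val L) j)%N ->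
  interlaced (val L) (val K).
Proof.
move=> sC KC LC; have /sorted_pairP[|//] := sC K L KC LC => h le.
have hle (j : 'I_n.+1) : (below (val L) j <= below (val K) j)%N.
  by have /andP[] := h j (ltn_ord j : (j < n.+1)%N).
have [le' eq] := leqif_sum (fun j (_ : true) => leqif_eq (hle j)).
have /forallP e : [forall j : 'I_n.+1, below (val L) j == below (val K) j].
  by move: eq; rewrite eqn_leq le' le => /esym.
move=> j jn; have := e (Ordinal (jn : (j < n.+1)%N)) => /= /eqP ->.
by rewrite leqnn leqnSn.
Qed.

(** [below] is a partial sum of the coordinates of [eps]. *)
Lemma sum_eps_below (R : realType) k n (C : {set ksubset k n}) (c : ksubset k n -> R) j :
  (j <= n)%N -> \sum_(I in C) c I *: eps R I = 0 ->
  \sum_(I in C) c I * (below (val I) j)%:R = 0.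
Proof.
move=> jn /rowP e; elim: j jn => [|j IHj] jn.
  by rewrite big1 // => I _; rewrite below0 mulr0.
have := e (Ordinal jn); rewrite summxE mxE => ej.
transitivity (\sum_(I in C) c I * (below (val I) j)%:R +
              \sum_(I in C) (c I *: eps R I) 0 (Ordinal jn)).
  rewrite -big_split; apply: eq_bigr => I _ /=.
  by rewrite !mxE (belowS _ (Ordinal jn)) natrD mulrDr.
by rewrite IHj ?ej ?addr0 // ltnW.
Qed.

(* Ordering a sorted collection by [below], its two largest members in the
   support of a relation differ at a place where all the others agree. *)
Lemma sorted_affinely_independent (R : realType) k n (C : {set ksubset k n})
    (c : ksubset k n -> R) : sorted_collection C ->
  \sum_(I in C) c I = 0 -> \sum_(I in C) c I *: eps R I = 0 ->
  forall I, I \in C -> c I = 0.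
Proof.
move=> sC c0 ce I IC; apply/eqP/negPn/negP=> cI.
pose w (K : ksubset k n) := (\sum_(j < n.+1) below (val K) j)%N.
pose P (K : ksubset k n) := (K \in C) && (c K != 0).
have PI : P I by rewrite /P IC.
case: (arg_maxnP w PI) => I1 /andP[I1C cI1] max1.
have [I2 I2P | only] := pickP [pred K | P K & K != I1]; last first.
  move/eqP: cI1; apply; rewrite -c0 (bigD1 I1) //= big1 ?addr0 // => K /andP[KC KI].
  by apply/eqP; have := only K; rewrite /= KI /P KC andbT => /negbFE.
case: (arg_maxnP w I2P) => I3 /andP[PI3 I31] max2; have /andP[I3C _] := PI3.
have [j jn ne] : exists2 j, (j <= n)%N & below (val I1) j != below (val I3) j.
  case: (boolP [forall j : 'I_n.+1, below (val I1) j == below (val I3) j]).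
    move=> /forallP h; case/eqP: I31; apply/esym/val_inj/below_inj => j jn.
    exact/eqP/(h (Ordinal (jn : (j < n.+1)%N))).
  by move=> /forallPn[j hj]; exists j; rewrite // -ltnS.
pose b (K : ksubset k n) := below (val K) j.
have le_b (K L : ksubset k n) : P K -> P L -> (w K <= w L)%N -> (b K <= b L <= (b K).+1)%N.
  by move=> /andP[KC _] /andP[LC _] h; apply: interlaced_of_weight sC KC LC h j jn.
have PI1 : P I1 by rewrite /P I1C.
have b1 : b I1 = (b I3).+1.
  rewrite -/(b I1) -/(b I3) in ne; move: ne (le_b I3 I1 PI3 PI1 (max1 _ PI3)).
  by move: (b I1) (b I3) => x y; clear; lia.
move/eqP: cI1; apply; have := sum_eps_below jn ce.
(* The coefficients sum to 0, so the constant [b I3] may be subtracted. Every other K in the support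
   is squeezed to [b K = b I3], and only the term of I1 survives, with factor 1. *)
have -> : \sum_(K in C) c K * (below (val K) j)%:R =
          \sum_(K in C) c K * ((b K)%:R - (b I3)%:R).
  rewrite [RHS](eq_bigr (fun K => c K * (b K)%:R - c K * (b I3)%:R)).
    by rewrite sumrB -mulr_suml c0 mul0r subr0.
  by move=> K _; rewrite mulrBr.
rewrite (bigD1 I1) //= big1 ?addr0 => [|K /andP[KC K1]].
  by rewrite b1 -natr1 addrAC subrr add0r mulr1.
have [->|cK] := eqVneq (c K) 0; first by rewrite mul0r.
have PK : P K by rewrite /P KC.
have h3 : (w K <= w I3)%N by apply: max2; rewrite /= PK.
have -> : b K = b I3.
  move: b1 (le_b K I1 PK PI1 (max1 _ PK)) (le_b K I3 PK PI3 h3).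
  by move: (b K) (b I1) (b I3) => x y z; clear; lia.
by rewrite subrr mulr0.
Qed.

(** * Convex hulls, vertices and facets *)

Lemma mem_hull (R : realType) n (T : finType) (v : T -> 'rV[R]_n) (A : {set T}) t :
  t \in A -> hull v A (v t).
Proof.
move=> tA; exists (fun u => (u == t)%:R); split=> [u||]; first exact: ler0n.
- by rewrite (bigD1 t) //= eqxx big1 ?addr0 // => u /andP[_ /negPf->].
- by rewrite (bigD1 t) //= eqxx scale1r big1 ?addr0 // => u /andP[_ /negPf->]; rewrite scale0r.
Qed.

(** The weights are pushed forward along a choice of a point of B for each point of A; the choice g
    is option-valued because U may be empty. *)
Lemma hull_sub (R : realType) n (T U : finType) (v : T -> 'rV[R]_n) (w : U -> 'rV[R]_n)
    (A : {set T}) (B : {set U}) :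
  (forall t, t \in A -> exists2 u, u \in B & v t = w u) ->
  forall x, hull v A x -> hull w B x.
Proof.
move=> AB x [c [c0 c1 ->]].
pose g t := [pick u in B | v t == w u].
have gP t : t \in A -> exists2 u, u \in B & g t = Some u /\ v t = w u.
  move=> tA; rewrite /g; case: pickP => [u /andP[uB /eqP e]|no]; first by exists u.
  by have [u uB e] := AB t tA; have := no u; rewrite uB e eqxx.
have sumg (V : nmodType) (h : T -> U -> V) :
    \sum_(u in B) \sum_(t in A | g t == Some u) h t u =
    \sum_(t in A) \sum_(u in B | g t == Some u) h t u.
  rewrite (exchange_big_dep (fun t => t \in A)) //=; last by move=> u t _ /andP[].
  by apply: eq_bigr => t tA; apply: eq_bigl => u; rewrite tA.
have pickg (V : nmodType) t (h : U -> V) u : u \in B -> g t = Some u ->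
    \sum_(u in B | g t == Some u) h u = h u.
  move=> uB gt; rewrite (bigD1 u) ?uB ?gt //= big1 ?addr0 // => u' /andP[/andP[_ /eqP[->]]].
  by rewrite eqxx.
exists (fun u => \sum_(t in A | g t == Some u) c t); split.
- by move=> u; apply: sumr_ge0.
- rewrite sumg -[RHS]c1; apply: eq_bigr => t /gP[u uB [gt _]].
  exact: (pickg _ t (fun=> c t) u).
rewrite [RHS](eq_bigr (fun u => \sum_(t in A | g t == Some u) c t *: w u)); last first.
  by move=> u _; rewrite scaler_suml.
rewrite sumg; apply: eq_bigr => t /gP[u uB [gt ->]].
by rewrite (pickg _ t (fun u => c t *: w u) u).
Qed.

Lemma eps_inj (R : realType) k n : injective (@eps R k n).
Proof.
move=> I J /rowP e; apply/val_inj/setP=> x; have := e x; rewrite !mxE => /eqP.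
by rewrite eqr_nat; do 2!case: (_ \in _).
Qed.

Lemma nabla_cube (R : realType) k n (C : {set ksubset k n}) x i :
  nabla R C x -> 0 <= x 0 i <= 1.
Proof.
move=> [c [c0 c1 ->]]; rewrite summxE.
have cE I : (c I *: eps R I) 0 i = c I * (i \in val I)%:R by rewrite !mxE.
apply/andP; split; first by apply: sumr_ge0 => I _; rewrite cE mulr_ge0.
rewrite -c1; apply: ler_sum => I _; rewrite cE ler_piMr //.
by case: (_ \in _); rewrite ?lexx ?ler01.
Qed.

Lemma sum1_neq0 (R : numDomainType) (T : finType) (A : pred T) (c : T -> R) :
  \sum_(t | A t) c t = 1 -> exists2 t, A t & c t != 0.
Proof.
move=> c1; have [t /andP[tA ct]|no] := pickP [pred t | A t & c t != 0]; first by exists t.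
have := oner_neq0 R; rewrite -c1 big1 ?eqxx // => t tA.
by have := no t; rewrite /= tA => /negbFE/eqP.
Qed.

(* [eps I] is an extreme point of the cube. *)
Lemma eps_extreme (R : realType) k n (I : ksubset k n) (T : finType) (v : T -> 'rV[R]_n)
    (A : {set T}) :
  (forall t i, t \in A -> 0 <= v t 0 i <= 1) -> hull v A (eps R I) ->
  exists2 t, t \in A & v t = eps R I.
Proof.
move=> cube [c [c0 c1 e]]; have [t tA ct] := sum1_neq0 c1; exists t => //.
have sumE i : \sum_(t in A) c t * v t 0 i = (i \in val I)%:R.
  have -> : (i \in val I)%:R = eps R I 0 i by rewrite mxE.
  by rewrite e summxE; apply: eq_bigr => u _; rewrite !mxE.
apply/rowP=> i; rewrite mxE; have := sumE i; case: (i \in val I) => /= s.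
  have z : \sum_(t in A) c t * (1 - v t 0 i) = 0.
    rewrite (eq_bigr (fun t => c t - c t * v t 0 i)); last by move=> u _; rewrite mulrBr mulr1.
    by rewrite sumrB c1 s subrr.
  have h : c t * (1 - v t 0 i) = 0.
    apply: (psumr_eq0P _ z) => // u uA; rewrite mulr_ge0 // subr_ge0.
    by case/andP: (cube u i uA).
  by move/eqP: h; rewrite mulf_eq0 (negPf ct) subr_eq0 => /eqP.
have h : c t * v t 0 i = 0.
  apply: (psumr_eq0P _ s) => // u uA; rewrite mulr_ge0 //.
  by case/andP: (cube u i uA).
by move/eqP: h; rewrite mulf_eq0 (negPf ct) => /eqP.
Qed.

(** Extremality keeps other indicator vectors out of the hull, so the point set determines the
    collection. *)
Lemma eps_nabla (R : realType) k n (C : {set ksubset k n}) (I : ksubset k n) :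
  nabla R C (eps R I) <-> I \in C.
Proof.
split=> [h|]; last exact: mem_hull.
have [|K KC /eps_inj <- //] := eps_extreme _ h.
by move=> K i KC; apply/(@nabla_cube R _ _ C)/mem_hull.
Qed.

Lemma nabla_inj (R : realType) k n : injective (@nabla R k n).
Proof.
move=> C D e; apply/setP=> I; apply/idP/idP => /(eps_nabla R).
  by rewrite e => /eps_nabla.
by rewrite -e => /eps_nabla.
Qed.

Lemma affinely_independent_inj (R : realType) n (T : finType) (v : T -> 'rV[R]_n) :
  affinely_independent v -> injective v.
Proof.
move=> ai t u tu; apply/eqP/negPn/negP=> ne.
have := ai (fun s => (s == t)%:R - (s == u)%:R).
have pick (s : T) (V : lmodType R) (h : T -> V) : \sum_r (r == s)%:R *: h r = h s.
  by rewrite (bigD1 s) //= eqxx scale1r big1 ?addr0 // => r /negPf->; rewrite scale0r.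
have pick1 (s : T) : \sum_r (r == s)%:R = 1 :> R.
  by rewrite (bigD1 s) //= eqxx big1 ?addr0 // => r /negPf->.
rewrite sumrB !pick1 subrr => /(_ erefl).
under eq_bigr do rewrite scalerBl.
rewrite sumrB !pick tu subrr => /(_ erefl t)/eqP.
by rewrite eqxx (negPf ne) subr0 oner_eq0.
Qed.

(** [vertex] and [facet] quantify over all presentations of a simplex; here every presentation is
    shown to have the indicator vectors of C as its vertices. *)
Lemma simplex_on_nablaP (R : realType) k n (C : {set ksubset k n}) d
    (v : 'I_d.+1 -> 'rV[R]_n) : simplex_on v (nabla R C) ->
  (forall i, exists2 I, I \in C & v i = eps R I) /\
  (forall I, I \in C -> exists i, eps R I = v i).
Proof.
move=> [ai e].
have onto I : I \in C -> exists i, eps R I = v i.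
  move=> IC; have h : hull v [set: 'I_d.+1] (eps R I) by rewrite -e; apply/eps_nabla.
  have [|i _ <-] := eps_extreme _ h; last by exists i.
  by move=> i j _; apply: (@nabla_cube R _ _ C); rewrite e; apply: mem_hull; rewrite inE.
split=> // i; have : nabla R C (v i) by rewrite e; apply: mem_hull; rewrite inE.
case=> c [c0 c1 vi].
pose g (I : ksubset k n) := odflt i [pick j | eps R I == v j].
have gP I : I \in C -> eps R I = v (g I).
  move=> /onto[j ej]; rewrite /g; case: pickP => [j' /eqP //|/(_ j)].
  by rewrite ej eqxx.
have part (V : nmodType) (h : ksubset k n -> V) :
    \sum_j \sum_(I in C | g I == j) h I = \sum_(I in C) h I.
  by rewrite (partition_big g xpredT).
(* Two expressions of [v i] are compared: the hull combination regrouped along g, and [v i] itself.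
   Independence puts total weight 1 on i, so some I in C has [g I = i]. *)
have := ai (fun j => \sum_(I in C | g I == j) c I - (j == i)%:R).
rewrite sumrB part c1.
have -> : \sum_j (j == i)%:R = 1 :> R.
  by rewrite (bigD1 i) //= eqxx big1 ?addr0 // => r /negPf->.
rewrite subrr => /(_ erefl).
have vi1 : \sum_j (j == i)%:R *: v j = v i.
  by rewrite (bigD1 i) //= eqxx scale1r big1 ?addr0 // => r /negPf->; rewrite scale0r.
have -> : \sum_j (\sum_(I in C | g I == j) c I - (j == i)%:R) *: v j = 0.
  under eq_bigr do rewrite scalerBl.
  rewrite sumrB vi1 vi -part -sumrB big1 // => j _.
  rewrite scaler_suml; apply/eqP; rewrite subr_eq0; apply/eqP.
  by apply: eq_bigr => I /andP[IC /eqP <-]; rewrite -gP.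
move=> /(_ erefl i); rewrite eqxx => /eqP; rewrite subr_eq0 => /eqP /sum1_neq0[I].
by case/andP=> IC /eqP gi _; exists I; rewrite // gP // gi.
Qed.

Lemma facet_nablaP (R : realType) k n (C : {set ksubset k n}) F :
  facet F (nabla R C) -> exists2 I, I \in C & F = nabla R (C :\ I).
Proof.
move=> [d [v [sv [i ->]]]]; have [h1 h2] := simplex_on_nablaP sv.
have vinj := affinely_independent_inj sv.1.
have [I IC vi] := h1 i; exists I => //.
apply/seteqP; split; [apply: hull_sub => j | apply: hull_sub => K].
  rewrite !inE => ji; have [K KC vj] := h1 j; exists K; rewrite // !inE KC andbT.
  by apply: contraNneq ji => KI; apply/eqP/vinj; rewrite vi vj KI.
rewrite !inE => /andP[KI KC]; have [j ej] := h2 K KC; exists j; rewrite // !inE.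
by apply: contraNneq KI => ji; apply/eqP/(@eps_inj R); rewrite ej ji vi.
Qed.

(** Affine independence, known for coefficients on C, is transported along an enumeration of C. *)
Lemma simplex_on_nabla (R : realType) k n (C : {set ksubset k n}) d :
  sorted_collection C -> #|C| = d.+1 ->
  exists2 g : 'I_d.+1 -> ksubset k n, injective g /\ g @: setT = C &
    simplex_on (eps R \o g) (nabla R C).
Proof.
move=> sC Cd; pose g (i : 'I_d.+1) : ksubset k n := enum_val (cast_ord (esym Cd) i).
have ginj : injective g by move=> i j /enum_val_inj /cast_ord_inj.
have gC : g @: setT = C.
  apply/eqP; rewrite eqEcard card_imset // cardsT card_ord Cd leqnn andbT.
  by apply/subsetP=> _ /imsetP[i _ ->]; apply: enum_valP.
exists g => //; split=> [c c0 ce i|].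
  pose c' I := \sum_(j | g j == I) c j.
  have c'g j : c' (g j) = c j.
    by rewrite /c' (eq_bigl (pred1 j)) ?big_pred1_eq // => j'; apply: inj_eq.
  have sumC (V : nmodType) (h : ksubset k n -> V) : \sum_(I in C) h I = \sum_j h (g j).
    rewrite -gC big_imset //=; last by move=> ? ? _ _; apply: ginj.
    by apply: eq_bigl => j; rewrite inE.
  rewrite -c'g; apply: (sorted_affinely_independent sC); last by rewrite -gC imset_f.
    by rewrite sumC -[RHS]c0; apply: eq_bigr => j _.
  by rewrite sumC -[RHS]ce; apply: eq_bigr => j _; rewrite c'g.
apply/seteqP; split; [apply: hull_sub => I | apply: hull_sub => j _].
  by rewrite -gC => /imsetP[j _ ->]; exists j.
by exists (g j); rewrite // -gC imset_f.
Qed.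

Lemma facet_nabla (R : realType) k n (C : {set ksubset k n}) I :
  sorted_collection C -> I \in C -> facet (nabla R (C :\ I)) (nabla R C).
Proof.
move=> sC IC; have Cd : #|C| = (#|C|.-1).+1 by rewrite prednK // (cardD1 I) IC.
have [g [ginj gC] sg] := simplex_on_nabla R sC Cd.
have /imsetP[i _ Ii] : I \in g @: setT by rewrite gC.
exists #|C|.-1, (eps R \o g); split=> //; exists i.
apply/seteqP; split; [apply: hull_sub => K | apply: hull_sub => j].
  case/setD1P=> KI KC; have /imsetP[j _ Kj] : K \in g @: setT by rewrite gC.
  exists j; rewrite /= ?Kj // !inE.
  by apply: contraNneq KI => ji; rewrite Kj Ii ji.
rewrite !inE => ji; exists (g j); rewrite // in_setD1 Ii (inj_eq ginj) ji.
by have : g j \in g @: setT by [apply: imset_f]; rewrite gC.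
Qed.

Lemma vertex_nabla (R : realType) k n (C : {set ksubset k n}) I :
  vertex (eps R I) (nabla R C) -> I \in C.
Proof.
move=> [d [v [[_ e] [i ei]]]]; apply/(eps_nabla R).
by rewrite e ei; apply: mem_hull; rewrite inE.
Qed.

(** * Largest and second largest minors *)

Lemma sorted_pair_refl k n (I : ksubset k n) : sorted_pair I I.
Proof. by apply/sorted_pairP; left => j _; rewrite leqnn leqnSn. Qed.

Lemma sorted_pair_sym k n (I J : ksubset k n) : sorted_pair I J = sorted_pair J I.
Proof. by apply/sorted_pairP/sorted_pairP; case; [right | left | right | left]. Qed.

Lemma arrangement_le (R : realType) k n l (U : 'I_l.+1 -> {set ksubset k n}) :
  arrangement R U -> exists A : 'M[R]_(k, n), positive_rep A /\
    forall (i j : 'I_l.+1) (I J : ksubset k n), I \in U i -> J \in U j -> (i <= j)%N ->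
    minor A I <= minor A J.
Proof.
move=> [_ _ _ [A [posA eqA ltA]]]; exists A; split=> // i j I J Ii Jj.
rewrite leq_eqVlt => /predU1P[/val_inj ij|ij]; last exact/ltW/(ltA i j).
by rewrite (eqA i I J) // ij.
Qed.

(** For an unsorted pair of largest minors, the square of the maximal value would be smaller than a
    product of two minors. *)
Lemma arrangement_of_largest_sorted (R : realType) k n (J : {set ksubset k n}) :
  arrangement_of_largest R J -> sorted_collection J.
Proof.
move=> [l [U [arrU <-]]] K L KJ LJ; apply/negPn/negP=> nKL.
have [A [posA leA]] := arrangement_le arrU.
have [_ _ cover _] := arrU.
have [S [T [_]]] := unsorted_minor_lt posA nKL.
apply/negP; rewrite -leNgt; apply: ler_pM; try exact/ltW/posA.2.
  by have [i Si] := cover S; apply: leA Si KJ (leq_ord i).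
by have [i Ti] := cover T; apply: leA Ti LJ (leq_ord i).
Qed.

(** Some k-subset exists as k <= n, and it lies in a block; for l = 0 the only block would be the
    empty U_0. *)
Lemma arrangement_of_largest_gt0 (R : realType) k n (J : {set ksubset k n}) :
  (k <= n)%N -> arrangement_of_largest R J -> (0 < #|J|)%N.
Proof.
move=> kn [l [U [[U0 _ cover _] <-]]]; rewrite card_gt0 U0 -val_eqE /=.
have cI : #|[set widen_ord kn x | x : 'I_k]| == k.
  by rewrite card_imset ?cardsT ?card_ord // => x y /(congr1 val) /= /val_inj.
have [i] := cover (exist (fun I : {set 'I_n} => #|I| == k) _ cI); case: (eqVneq l 0%N) => // l0.
by have /eqP -> : U i == set0 by [rewrite U0 -val_eqE /=; have := leq_ord i; lia]; rewrite inE.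
Qed.

(* The maximal value being [M] and the next one [m], a pair with product
   larger than [m * M] must consist of two maximal minors. *)
Lemma unsorted_second_minor (R : realType) k n (J : {set ksubset k n}) (W K : ksubset k n) :
  largest_minor R 2 J W -> K \in J -> ~~ sorted_pair W K ->
  exists S T, [/\ S \in J, T \in J & eps R W + eps R K = eps R S + eps R T].
Proof.
move=> [Y [l [U [i [arrU <- i0 il <-]]]] WU] KJ nWK.
have [A [posA leA]] := arrangement_le arrU; have [_ _ cover _] := arrU.
have [S [T [e lt]]] := unsorted_minor_lt posA nWK.
have leK V : minor A V <= minor A K.
  by have [j Vj] := cover V; apply: leA Vj KJ (leq_ord j).
have leW V : V \notin U ord_max -> minor A V <= minor A W.
  have [j Vj] := cover V; have [jl|jl VU] := eqVneq j ord_max; first by rewrite -jl Vj.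
  by apply: leA Vj WU _; move: jl; rewrite -val_eqE /=; have := leq_ord j; lia.
exists S, T; split=> //; apply: contraLR lt => /leW h; rewrite -leNgt.
  by apply: ler_pM => //; exact/ltW/posA.2.
by rewrite mulrC; apply: ler_pM => //; exact/ltW/posA.2.
Qed.

(** K and L each give an affine expression of [eps R W] over J. The first has coefficient -1 at K,
    the second a nonnegative one there if K and L differ, contradicting affine independence. *)
Lemma second_minor_unsorted_unique (R : realType) k n (J : {set ksubset k n})
    (W K L : ksubset k n) :
  sorted_collection J -> W \notin J -> largest_minor R 2 J W ->
  K \in J -> L \in J -> ~~ sorted_pair W K -> ~~ sorted_pair W L -> K = L.
Proof.
move=> sJ WJ Wlargest KJ LJ nWK nWL; apply/eqP/negPn/negP=> KL.
have [S [T [SJ TJ e]]] := unsorted_second_minor Wlargest KJ nWK.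
have [S' [T' [SJ' TJ' e']]] := unsorted_second_minor Wlargest LJ nWL.
(* If K cancelled in the relation, W would equal S or T and so lie in J. *)
have SK : S != K.
  apply: contraNneq WJ => SK; move: e; rewrite SK addrC => /addrI/eps_inj -> //.
have TK : T != K.
  by apply: contraNneq WJ => TK; move: e; rewrite TK => /addIr/eps_inj ->.
(* [d A B D] is the coefficient function of eps_A + eps_B - eps_D. *)
pose d (A B D I : ksubset k n) : R := (I == A)%:R + (I == B)%:R - (I == D)%:R.
have pick1 I : I \in J -> \sum_(I' in J) (I' == I)%:R = 1 :> R.
  by move=> IJ; rewrite (bigD1 I) //= eqxx big1 ?addr0 // => I' /andP[_ /negPf->].
have pick I : I \in J -> \sum_(I' in J) (I' == I)%:R *: eps R I' = eps R I.
  move=> IJ; rewrite (bigD1 I) //= eqxx scale1r big1 ?addr0 // => I' /andP[_ /negPf->].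
  by rewrite scale0r.
have d1 A B D : A \in J -> B \in J -> D \in J -> \sum_(I in J) d A B D I = 1.
  by move=> AJ BJ DJ; rewrite sumrB big_split /= !pick1 // addrK.
have dpick A B D : A \in J -> B \in J -> D \in J ->
    \sum_(I in J) d A B D I *: eps R I = eps R A + eps R B - eps R D.
  move=> AJ BJ DJ; rewrite -(pick A) // -(pick B) // -(pick D) // -big_split -sumrB.
  by apply: eq_bigr => I _; rewrite scalerBl scalerDl.
pose c I := d S T K I - d S' T' L I.
have c0 : \sum_(I in J) c I = 0.
  by rewrite [LHS]sumrB (d1 S) // (d1 S') // subrr.
have ce : \sum_(I in J) c I *: eps R I = 0.
  under eq_bigr do rewrite scalerBl.
  by rewrite [LHS]sumrB (dpick S) // (dpick S') // -e -e' !addrK subrr.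
have := sorted_affinely_independent sJ c0 ce KJ; rewrite /c /d.
rewrite [K == S]eq_sym [K == T]eq_sym (negPf SK) (negPf TK) (negPf KL) eqxx.
move: (ler0n R (K == S')) (ler0n R (K == T')).
by move: (_ %:R) (_ %:R) => x y /= x0 y0; rewrite !mulr0n mulr1n; clear -x0 y0; lra.
Qed.

(** * Conditions on collections and on simplices *)

Theorem theorem4p6 (R : realType) (k n : nat) (hk : (1 <= k)%N) (hkn : (k <= n)%N)
    (J : {set ksubset k n}) (hJ : arrangement_of_largest R J)
    (W : ksubset k n) (hW : W \notin J) :
  let c := #|J| in
  let cond1 := sorted_collection (W |: J) in
  let cond2 := exists2 J0 : ksubset k n, J0 \in J &
    ~~ sorted_pair W J0 /\ sorted_collection (W |: (J :\ J0)) in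
  let cond3 := sturmfels R k n (nabla R (W |: J)) /\
    simplex c (nabla R (W |: J)) in
  let cond4 := exists Y : {set ksubset k n},
    [/\ sturmfels R k n (nabla R Y), simplex c.-1 (nabla R Y),
        vertex (eps R W) (nabla R Y)
      & exists F : set 'rV[R]_n, facet F (nabla R Y) /\ facet F (nabla R J)] in
  (largest_minor R 2 J W -> cond1 \/ cond2) /\
  (cond1 \/ cond2 <-> cond3 \/ cond4).
Proof.
move=> c cond1 cond2 cond3 cond4.
have sJ : sorted_collection J by apply: arrangement_of_largest_sorted hJ.
have c0 : (0 < c)%N by apply: arrangement_of_largest_gt0 hkn hJ.
have add_sorted : {in J, forall K, sorted_pair W K} -> cond1.
  move=> WJ K L; rewrite !inE => /predU1P[->|KJ] /predU1P[->|LJ].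
  - exact: sorted_pair_refl.
  - exact: WJ.
  - by rewrite sorted_pair_sym WJ.
  - exact: sJ.
split=> [Wlargest|].
  (* Either W is sorted with all of J, or uniqueness of the unsorted partner J0 leaves W sorted with
     the rest. *)
  have [/existsP[J0 /andP[J0J nWJ0]]|/existsPn no] :=
      boolP [exists K, (K \in J) && ~~ sorted_pair W K]; last first.
    by left; apply: add_sorted => K KJ; have := no K; rewrite KJ negbK.
  have WJ K : K \in J :\ J0 -> sorted_pair W K.
    rewrite !inE => /andP[KJ0 KJ]; apply: contraNT KJ0 => nWK; apply/eqP.
    exact: second_minor_unsorted_unique sJ hW Wlargest KJ J0J nWK nWJ0.
  right; exists J0 => //; split=> // K L.
  move=> /setU1P[->|KJ] /setU1P[->|LJ].
  - exact: sorted_pair_refl.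
  - exact: WJ.
  - by rewrite sorted_pair_sym WJ.
  by apply: sJ; [case/setD1P: KJ | case/setD1P: LJ].
(* The implications are (1) to (3), (2) to (4), (3) to (1), and (4) to (1) or (2). *)
split=> [[c1|[J0 J0J [nWJ c2]]]|[[[C sC e] _]|[Y [[C sC e] _ vW [F [fY fJ]]]]]].
- left; split; first by exists (W |: J).
  have [|g _ sg] := simplex_on_nabla R c1 (_ : _ = c.+1); first by rewrite cardsU1 hW.
  by exists (eps R \o g).
- right; exists (W |: (J :\ J0)).
  have cY : #|W |: (J :\ J0)| = c.-1.+1.
    by rewrite cardsU1 !inE (negPf hW) andbF /= add1n /c (cardsD1 J0 J) J0J.
  have [g [_ gY] sg] := simplex_on_nabla R c2 cY.
  split; first by exists (W |: (J :\ J0)).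
  + by exists (eps R \o g).
  + have /imsetP[i _ Wi] : W \in g @: setT by rewrite gY setU11.
    by exists c.-1, (eps R \o g); split=> //; exists i; rewrite /= -Wi.
  exists (nabla R (J :\ J0)); split; last exact: facet_nabla.
  have {1}-> : J :\ J0 = (W |: (J :\ J0)) :\ W.
    by rewrite setU1K // !inE (negPf hW) andbF.
  by apply: facet_nabla; rewrite // setU11.
- by left; rewrite /cond1 (nabla_inj e).
have sY : sorted_collection Y by rewrite (nabla_inj e).
have WY := vertex_nabla vW.
have [Y0 Y0Y FY] := facet_nablaP fY; have [J0 J0J FJ] := facet_nablaP fJ.
have eYJ : Y :\ Y0 = J :\ J0 by apply: (@nabla_inj R); rewrite -FY -FJ.
(* The common facet uses only members of J, so the vertex W must be the one removed from Y. *)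
have WY0 : W = Y0.
  apply/eqP; apply: contraNT hW => WY0.
  by have : W \in J :\ J0 by [rewrite -eYJ !inE WY0]; rewrite inE => /andP[].
have YE : W |: (J :\ J0) = Y by rewrite -eYJ WY0 setD1K.
(* Y is J with J0 replaced by W. If W and J0 happen to be sorted, (1) holds; otherwise (2). *)
case: (boolP (sorted_pair W J0)) => [WJ0|nWJ0]; last first.
  by right; exists J0; rewrite // YE.
left; apply: add_sorted => K KJ; have [-> //|KJ0] := eqVneq K J0.
by apply: sY WY _; rewrite -YE !inE KJ KJ0 orbT.
Qed.
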